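(* Let $\Omega$ be a volume $m$-form on a manifold $M$ and let $\alpha$ be an $(m-k)$-form on $M$. Then the $k$-bracket of functions $f_1,\dots,f_k\in C^\infty(M)$ defined by $$\{f_1,\dots,f_k\}\,\Omega = \mathrm{d}f_1\wedge\cdots\wedge \mathrm{d}f_k\wedge\alpha$$ is generated by the $k$-vector field $\Lambda$ defined by $i_\Lambda\Omega=\alpha$, i.e. $$\{f_1,\dots,f_k\}=\langle \mathrm{d}f_1\wedge\cdots\wedge \mathrm{d}f_k,\Lambda\rangle .$$
   Context: $M$ is a smooth manifold of dimension $m$ and a volume form is a nowhere vanishing $m$-form. A $k$-vector field is a section of $\bigwedge^k TM$; $\langle\cdot,\cdot\rangle$ is the natural pairing of $k$-forms with $k$-vector fields, $\langle \theta_1\wedge\cdots\wedge\theta_k, X_1\wedge\cdots\wedge X_k\rangle=\det(\theta_i(X_j))$. Contraction of a form with a multivector field uses the convention $i_{X_1\wedge\cdots\wedge X_k}=i_{X_k}\cdots i_{X_1}$, where $i_X\eta=\eta(X,\cdot,\dots,\cdot)$ is the usual interior product by a vector field, extended linearly over functions. Since $\Omega$ is a volume form, $\Lambda\mapsto i_\Lambda\Omega$ is an isomorphism from $k$-vector fields to $(m-k)$-forms, so $\Lambda$ is well defined by $i_\Lambda\Omega=\alpha$. *)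

(* Defs.v *)
From HB Require Import structures.
From mathcomp Require Import all_boot all_order all_algebra all_fingroup.
From mathcomp Require Import all_classical all_reals all_analysis zify.
Set Implicit Arguments.
Unset Strict Implicit.
Unset Printing Implicit Defensive.
Import Order.TTheory GRing.Theory Num.Theory numFieldNormedType.Exports.
Local Open Scope classical_set_scope.
Local Open Scope ring_scope.

(** * Multilinear algebra on R^m

    A tuple of k vectors of R^m is the matrix 'M[R]_(k, m) of its rows, so a
    k-form on R^m is a function 'M[R]_(k, m) -> R.  A k-vector, i.e. an element
    of the k-th exterior power of R^m, is represented by the corresponding
    skew-symmetric contravariant tensor: an alternating multilinear function of
    k covectors.  A covector is the row of its coordinates in the dual basis,
    and a k-tuple of covectors is again a matrix 'M[R]_(k, m). *)
Section MultilinearAlgebra.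
Context {R : realType} {m : nat}.

(* Same shape as [determinant_multilinear] and [determinant_alternate]. *)
Definition alternating_multilinear k (w : 'M[R]_(k, m) -> R) :=
  (forall (A B C : 'M[R]_(k, m)) (i : 'I_k) (b c : R),
     row i A = b *: row i B + c *: row i C ->
     row' i B = row' i A -> row' i C = row' i A ->
     w A = b * w B + c * w C)
  /\ (forall (A : 'M[R]_(k, m)) (i j : 'I_k),
        i != j -> row i A = row j A -> w A = 0).

(* The degree n of the product is tied to k + l by a proof, in order to avoid
   casts between forms of degree m and of degree k + (m - k). *)
Definition wedge_product k l n (e : (k + l = n)%N)
    (a : 'M[R]_(k, m) -> R) (b : 'M[R]_(l, m) -> R) : 'M[R]_(n, m) -> R :=
  fun V => (k`!%:R * l`!%:R)^-1 *
    \sum_(s : 'S_n)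
      let W := castmx (esym e, erefl m) (row_perm s V) in
      (-1) ^+ s * a (usubmx W) * b (dsubmx W).

(* theta_1 /\ ... /\ theta_k; [wedge_product_covectors] below shows that this is
   the iterated [wedge_product]. *)
Definition wedge_covectors k (theta : 'I_k -> 'rV[R]_m -> R) :
    'M[R]_(k, m) -> R :=
  fun X => \det (\matrix_(i, j) theta i (row j X)).

(* X_1 /\ ... /\ X_k as a function of the covectors *)
Definition wedge_vectors k (X : 'M[R]_(k, m)) : 'M[R]_(k, m) -> R :=
  fun Theta => \det (Theta *m X^T).

(* (e_(I 0), ..., e_(I (k - 1))): a tuple of vectors of the standard basis, or
   of covectors of its dual basis *)
Definition basis_tuple k (I : {ffun 'I_k -> 'I_m}) : 'M[R]_(k, m) :=
  \matrix_(i, j) (j == I i)%:R.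

(* Contraction over all multi-indices, whence the factor 1/k!.  By
   [pairing_wedge_vectors] it is the bilinear extension of
   <theta_1 /\ .. /\ theta_k, X_1 /\ .. /\ X_k> = det (theta_i (X_j)). *)
Definition pairing k (w L : 'M[R]_(k, m) -> R) : R :=
  k`!%:R^-1 *
    \sum_(I : {ffun 'I_k -> 'I_m}) w (basis_tuple I) * L (basis_tuple I).

(* The linear extension to all k-vectors L of i_(X_1 /\ .. /\ X_k) =
   i_(X_k) .. i_(X_1), see [interior_product_wedge_vectors]. *)
Definition interior_product k l n (e : (k + l = n)%N)
    (L : 'M[R]_(k, m) -> R) (w : 'M[R]_(n, m) -> R) : 'M[R]_(l, m) -> R :=
  fun V => pairing (fun U => w (castmx (e, erefl m) (col_mx U V))) L.

End MultilinearAlgebra.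

(** * The normalization conventions *)
Section Conventions.
Context {R : realType} {m : nat}.

Lemma row_expansion k (w : 'M[R]_(1 + k, m) -> R) :
  alternating_multilinear w -> forall (u : 'rV[R]_m) (Y : 'M[R]_(k, m)),
  w (col_mx u Y) = \sum_j u 0 j * w (col_mx (delta_mx 0 j) Y).
Proof.
move=> [wl _] u Y.
have ad (a b : R) (x y : 'rV[R]_m) : w (col_mx (a *: x + b *: y) Y)
   = a * w (col_mx x Y) + b * w (col_mx y Y).
  have E (z : 'rV[R]_m) : row (lshift k ord0) (col_mx z Y) = z.
    by rewrite rowKu row_id.
  have E' (z z' : 'rV[R]_m) :
      row' (lshift k ord0) (col_mx z Y) = row' (lshift k ord0) (col_mx z' Y).
    apply/matrixP => i j; rewrite !mxE.
    by case: splitP => // l /=; rewrite ord1.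
  by apply: (wl _ _ _ (lshift k ord0)); rewrite ?E //; exact: E'.
rewrite [in LHS](row_sum_delta u).
elim/big_rec2: _ => [|j a v _ IH].
  by have := ad 0 0 0 0; rewrite !scale0r !mul0r !addr0.
by have := ad (u 0 j) 1 (delta_mx 0 j) v; rewrite !scale1r mul1r => ->; rewrite IH.
Qed.

Lemma row'_col_mx l k (U U' : 'M[R]_(l, m)) (Y Y' : 'M[R]_(k, m)) (i : 'I_l) :
  row' i U = row' i U' -> Y = Y' ->
  row' (lshift k i) (col_mx U Y) = row' (lshift k i) (col_mx U' Y').
Proof.
move=> hU <-; apply/matrixP => a j; rewrite !mxE.
case: splitP => // b /= eb.
have ne : i != b.
  by apply/eqP => ib; have /eqP[] := neq_lift (lshift k i) a; apply/val_inj; rewrite /= eb ib.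
have [b' -> _] := unlift_some ne.
by move: hU => /matrixP/(_ b' j); rewrite !mxE.
Qed.

Lemma row'_col_mxd l k (U U' : 'M[R]_(l, m)) (Y Y' : 'M[R]_(k, m)) (i : 'I_k) :
  U = U' -> row' i Y = row' i Y' ->
  row' (rshift l i) (col_mx U Y) = row' (rshift l i) (col_mx U' Y').
Proof.
move=> <- hU; apply/matrixP => a j; rewrite !mxE.
case: splitP => // b /= eb.
have ne : i != b.
  by apply/eqP => ib; have /eqP[] := neq_lift (rshift l i) a; apply/val_inj; rewrite /= eb ib.
have [b' -> _] := unlift_some ne.
by move: hU => /matrixP/(_ b' j); rewrite !mxE.
Qed.

Lemma alternating_col_mxd l k (w : 'M[R]_(l + k, m) -> R) (U : 'M[R]_(l, m)) :
  alternating_multilinear w ->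
  alternating_multilinear (fun Y : 'M[R]_(k, m) => w (col_mx U Y)).
Proof.
move=> [wl wa]; split.
- move=> A B C i b c hA hB hC; apply: (wl _ _ _ (rshift l i)).
  + by rewrite !rowKd.
  + exact: row'_col_mxd.
  + exact: row'_col_mxd.
- move=> A i j ij hA; apply: (wa _ (rshift l i) (rshift l j)).
    by rewrite (inj_eq (@rshift_inj _ _)).
  by rewrite !rowKd.
Qed.

Lemma alternating_col_mxu l k (w : 'M[R]_(l + k, m) -> R) (Y : 'M[R]_(k, m)) :
  alternating_multilinear w ->
  alternating_multilinear (fun U : 'M[R]_(l, m) => w (col_mx U Y)).
Proof.
move=> [wl wa]; split.
- move=> A B C i b c hA hB hC; apply: (wl _ _ _ (lshift k i)).
  + by rewrite !rowKu.
  + exact: row'_col_mx.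
  + exact: row'_col_mx.
- move=> A i j ij hA; apply: (wa _ (lshift k i) (lshift k j)).
    by rewrite (inj_eq (@lshift_inj _ _)).
  by rewrite !rowKu.
Qed.

Lemma multilinear_expansion k (w : 'M[R]_(k, m) -> R) :
  alternating_multilinear w -> forall Y,
  w Y = \sum_(I : {ffun 'I_k -> 'I_m}) (\prod_i Y i (I i)) * w (basis_tuple I).
Proof.
elim: k w => [|k IH] w wA Y.
  have I0 : {ffun 'I_0 -> 'I_m} by apply: finfun; case.
  rewrite (big_pred1 I0) => [|I]; last by apply/esym/eqP/ffunP; case.
  by rewrite big_ord0 mul1r; congr w; apply/matrixP; case.
pose cons (p : 'I_m * {ffun 'I_k -> 'I_m}) : {ffun 'I_k.+1 -> 'I_m} :=
  [ffun i => if unlift ord0 i is Some i' then p.2 i' else p.1].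
pose uncons (I : {ffun 'I_k.+1 -> 'I_m}) : 'I_m * {ffun 'I_k -> 'I_m} :=
  (I ord0, [ffun i => I (lift ord0 i)]).
rewrite (reindex cons) /=; last first.
  exists uncons => [[j I]|I] _.
    congr pair; first by rewrite ffunE unlift_none.
    by apply/ffunP => i; rewrite !ffunE liftK.
  apply/ffunP => i; rewrite !ffunE /=.
  by case: unliftP => [i'|] ->; rewrite ?ffunE.
transitivity (w (col_mx (usubmx (Y : 'M[R]_(1 + k, m))) (dsubmx (Y : 'M[R]_(1 + k, m))))).
  by rewrite vsubmxK.
rewrite (row_expansion wA) -(pair_bigA _ (fun j I =>
  \prod_i Y i (cons (j, I) i) * w (basis_tuple (cons (j, I))))) /=.
apply: eq_bigr => j _.
rewrite (IH _ (@alternating_col_mxd 1 k w (delta_mx 0 j) wA)) mulr_sumr.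
apply: eq_bigr => I _; rewrite big_ord_recl mulrA; congr (_ * _ * _).
- by rewrite mxE ffunE unlift_none; congr (Y _ _); apply/val_inj.
- apply: eq_bigr => i _; rewrite mxE ffunE liftK; congr (Y _ _); exact/val_inj.
- congr w; apply/matrixP => a b; rewrite !mxE !ffunE.
  case: splitP => i /= ai; rewrite !mxE.
    by rewrite ord1 in ai *; rewrite (_ : a = ord0) ?unlift_none //; exact/val_inj.
  by rewrite (_ : a = lift ord0 i) ?liftK //; apply/val_inj; rewrite /= ai.
Qed.

Lemma alternating_perm k (w : 'M[R]_(k, m) -> R) :
  alternating_multilinear w -> forall (s : 'S_k) Y,
  w (row_perm s Y) = (-1) ^+ s * w Y.
Proof.
move=> wA s Y.
have sw i j Z : i != j -> w (xrow i j Z) = - w Z.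
  move=> ij.
  pose F (x y : 'rV[R]_m) := w (\matrix_(a, b)
     if a == i then x 0 b else if a == j then y 0 b else Z a b).
  have Fl x x' y : F (x + x') y = F x y + F x' y.
    have := wA.1; rewrite /F => /(_ _ _ _ i 1 1) => h.
    rewrite -[X in _ = X + _]mul1r -[X in _ = _ + X]mul1r; apply: h.
    - by apply/rowP => b; rewrite !mxE eqxx !mul1r.
    - by apply/matrixP => a b; rewrite !mxE eq_sym (negbTE (neq_lift _ _)).
    - by apply/matrixP => a b; rewrite !mxE eq_sym (negbTE (neq_lift _ _)).
  have Fr x y y' : F x (y + y') = F x y + F x y'.
    have := wA.1; rewrite /F => /(_ _ _ _ j 1 1) => h.
    rewrite -[X in _ = X + _]mul1r -[X in _ = _ + X]mul1r; apply: h.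
    - by apply/rowP => b; rewrite !mxE eqxx eq_sym (negbTE ij) !mul1r.
    - by apply/matrixP => a b; rewrite !mxE [lift j a == j]eq_sym (negbTE (neq_lift _ _)).
    - by apply/matrixP => a b; rewrite !mxE [lift j a == j]eq_sym (negbTE (neq_lift _ _)).
  have F0 x : F x x = 0.
    apply: (wA.2 _ _ _ ij); apply/rowP => b.
    by rewrite !mxE !eqxx eq_sym (negbTE ij).
  have -> : w Z = F (row i Z) (row j Z).
    congr w; apply/matrixP => a b; rewrite !mxE.
    by case: eqP => [->//|_]; case: eqP => [->|].
  have -> : w (xrow i j Z) = F (row j Z) (row i Z).
    congr w; apply/matrixP => a b; rewrite !mxE.
    by case: tpermP => [->|->|/eqP/negbTE-> /eqP/negbTE->//];
      rewrite ?eqxx // eq_sym (negbTE ij).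
  have := F0 (row i Z + row j Z); rewrite Fl !Fr !F0 add0r addr0 addrC.
  by move/eqP; rewrite addr_eq0 => /eqP.
have [ts -> dts] := prod_tpermP s.
elim: ts dts Y => [|t ts IH] /=.
  by move=> _ Y; rewrite big_nil row_perm1 odd_perm1 mul1r.
case/andP => dt dts Y; rewrite big_cons row_permM.
rewrite -/(xrow _ _ _) sw ?IH // odd_mul_tperm dt signr_addb expr1 mulN1r.
by rewrite mulNr.
Qed.

Lemma pairing_wedge_vectors k (w : 'M[R]_(k, m) -> R) (X : 'M[R]_(k, m)) :
  alternating_multilinear w -> pairing w (wedge_vectors X) = w X.
Proof.
move=> wA.
transitivity (k`!%:R^-1 * \sum_(s : 'S_k) (-1) ^+ s * w (row_perm s X)).
  congr (_ * _); transitivity (\sum_(I : {ffun 'I_k -> 'I_m}) \sum_(s : 'S_k)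
     (-1) ^+ s * ((\prod_i row_perm s X i (I i)) * w (basis_tuple I))).
    apply: eq_bigr => I _; rewrite mulrC mulr_suml.
    apply: eq_bigr => s _; rewrite mulrA; congr (_ * _ * _).
    apply: eq_bigr => i _; rewrite !mxE (bigD1 (I i)) //= !mxE eqxx mul1r.
    by rewrite big1 ?addr0 // => j /negbTE h; rewrite !mxE h mul0r.
  rewrite exchange_big; apply: eq_bigr => s _.
  by rewrite (multilinear_expansion wA) mulr_sumr.
rewrite (eq_bigr (fun=> w X)) => [|s _].
  rewrite sumr_const card_Sn -[w X *+ _]mulr_natl mulrA mulVf ?mul1r // pnatr_eq0 -lt0n fact_gt0.
by rewrite (alternating_perm wA) mulrA -expr2 sqrr_sign mul1r.
Qed.

Lemma interior_product_wedge_vectors k l n (e : (k + l = n)%N)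
    (w : 'M[R]_(n, m) -> R) (X : 'M[R]_(k, m)) (V : 'M[R]_(l, m)) :
  alternating_multilinear w ->
  interior_product e (wedge_vectors X) w V = w (castmx (e, erefl m) (col_mx X V)).
Proof.
case: n / e w => w wA.
rewrite /interior_product pairing_wedge_vectors //.
exact: alternating_col_mxu.
Qed.

Lemma wedge_product_covectors k l (theta : 'I_k -> 'rV[R]_m -> R)
    (eta : 'I_l -> 'rV[R]_m -> R) (V : 'M[R]_(k + l, m)) :
  wedge_product erefl (wedge_covectors theta) (wedge_covectors eta) V =
  wedge_covectors (fun i => match fintype.split i with
                            | inl a => theta a
                            | inr b => eta b
                            end) V.
Proof.
rewrite [RHS]/wedge_covectors; set N := \matrix_(_, _) _.
have lsplit (i : 'I_k) : fintype.split (lshift l i) = inl i.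
  exact: (unsplitK (inl i)).
have rsplit (i : 'I_l) : fintype.split (rshift k i) = inr i.
  exact: (unsplitK (inr i)).
transitivity ((k`!%:R * l`!%:R)^-1 * \sum_(s : 'S_(k + l)) (-1) ^+ s *
   ((\sum_(t : 'S_k) (-1) ^+ t * \prod_i N (lshift l i) (s (lshift l (t i)))) *
    (\sum_(t : 'S_l) (-1) ^+ t * \prod_i N (rshift k i) (s (rshift k (t i)))))).
  congr (_ * _); apply: eq_bigr => s _; rewrite /= -mulrA; congr (_ * (_ * _)).
    apply: eq_bigr => t _; congr (_ * _); apply: eq_bigr => i _.
    rewrite !mxE lsplit; congr (theta i _); apply/rowP => j.
    by rewrite castmx_id !mxE.
  apply: eq_bigr => t _; congr (_ * _); apply: eq_bigr => i _.
  rewrite !mxE rsplit; congr (eta i _); apply/rowP => j.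
  by rewrite castmx_id !mxE.
pose f (t : 'S_k) (t' : 'S_l) (i : 'I_(k + l)) : 'I_(k + l) :=
  match fintype.split i with
  | inl a => lshift l (t a) | inr b => rshift k (t' b) end.
have fK t t' : cancel (f t t') (f t^-1%g t'^-1%g).
  move=> i; rewrite /f; case: (splitP i) => j ij.
    by rewrite lsplit permK; apply/val_inj.
  by rewrite rsplit permK; apply/val_inj.
pose sg t t' : 'S_(k + l) := perm (can_inj (fK t t')).
have sgE t t' : (-1) ^+ sg t t' = (-1) ^+ t * (-1) ^+ t' :> R.
  rewrite -!det_perm -(det_ublock _ 0); congr (\det _).
  apply/matrixP => i j; rewrite !mxE permE /f.
  case: (splitP i) => a _; rewrite !mxE; case: (splitP j) => b jb; rewrite !mxE.
  - by rewrite -val_eqE /= jb.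
  - by rewrite -val_eqE /= jb; case: eqP => // h; have := ltn_ord (t a); lia.
  - by rewrite -val_eqE /= jb; case: eqP => // h; have := ltn_ord b; lia.
  - by rewrite -val_eqE /= jb eqn_add2l.
transitivity ((k`!%:R * l`!%:R)^-1 *
    \sum_(t : 'S_k) \sum_(t' : 'S_l) \det N).
  congr (_ * _).
  under eq_bigr do rewrite mulr_suml mulr_sumr.
  rewrite exchange_big; apply: eq_bigr => t _.
  under eq_bigr do rewrite mulr_sumr mulr_sumr.
  rewrite exchange_big; apply: eq_bigr => t' _.
  rewrite /determinant [RHS](reindex_inj (mulgI (sg t t'))) /=.
  apply: eq_bigr => s _.
  rewrite odd_permM signr_addb sgE big_split_ord /=.
  under [X in _ = _ * (X * _)]eq_bigr do rewrite permM permE /f lsplit.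
  under [X in _ = _ * (_ * X)]eq_bigr do rewrite permM permE /f rsplit.
  by rewrite mulrACA !mulrA [(-1) ^+ s * _]mulrC -!mulrA; congr (_ * _); rewrite mulrCA.
rewrite !sumr_const !card_Sn -mulrnA -[\det N *+ _]mulr_natl mulrA.
by rewrite mulnC natrM mulVf ?mul1r // mulf_neq0 // pnatr_eq0 -lt0n fact_gt0.
Qed.
End Conventions.

(** * Smooth manifolds *)
Section Smoothness.
Context {R : realType} {m : nat} {W : normedModType R}.

Fixpoint Cn_on (n : nat) (U : set 'rV[R]_m) (f : 'rV[R]_m -> W) : Prop :=
  match n with
  | 0 => forall x, U x -> {for x, continuous f}
  | n'.+1 => (forall x, U x -> differentiable f x) /\
             (forall v, Cn_on n' U ('D_v f))
  end.

Definition smooth_on (U : set 'rV[R]_m) (f : 'rV[R]_m -> W) :=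
  forall n, Cn_on n U f.

End Smoothness.

(* The values of [cmap] outside [cdom] and of [cinv] outside [cmap @` cdom] are
   irrelevant. *)
Record chart (R : realType) (m : nat) (M : topologicalType) := Chart {
  cdom : set M;
  cmap : M -> 'rV[R]_m;
  cinv : 'rV[R]_m -> M;
  cdom_open : open cdom;
  cimg_open : open (cmap @` cdom);
  cmapK : forall p, cdom p -> cinv (cmap p) = p;
  cmap_continuous : forall p, cdom p -> {for p, continuous cmap};
  cinv_continuous : forall x, (cmap @` cdom) x -> {for x, continuous cinv}
}.

Record manifold (R : realType) (m : nat) := Manifold {
  space :> topologicalType;
  space_hausdorff : hausdorff_space space;
  space_second_countable : @second_countable space;
  chart_index : Type;
  atlas : chart_index -> chart R m space;
  atlas_cover : forall p : space, exists c, cdom (atlas c) p;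
  atlas_smooth : forall c d : chart_index,
    smooth_on (cmap (atlas c) @` (cdom (atlas c) `&` cdom (atlas d)))
              (cmap (atlas d) \o cinv (atlas c))
}.
Arguments atlas {R m} M _ : rename.

Section Fields.
Context {R : realType} {m : nat} (M : manifold R m).

Definition chart_domain (c : chart_index M) : set M := cdom (atlas M c).

Definition chart_image (c : chart_index M) : set 'rV[R]_m :=
  cmap (atlas M c) @` chart_domain c.

Definition coordinates (c : chart_index M) : M -> 'rV[R]_m := cmap (atlas M c).

Definition parametrization (c : chart_index M) : 'rV[R]_m -> M :=
  cinv (atlas M c).

(* Jacobian at p of the change of coordinates from c to d.  A tangent vector at
   p with components v (a row) in c has components v *m transition c d p in d. *)
Definition transition (c d : chart_index M) (p : M) : 'M[R]_m :=
  jacobian (coordinates d \o parametrization c) (coordinates c p).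

Record smooth_function := SmoothFunction {
  fun_val :> M -> R;
  fun_smooth : forall c,
    smooth_on (chart_image c) (fun_val \o parametrization c)
}.

(* Tensor fields are given by their components in the charts: [w c p] is the
   value at p in the frame of T_p M defined by the chart c, and is only
   meaningful when p belongs to the domain of c. *)
Record diff_form (k : nat) := DiffForm {
  form_val :> chart_index M -> M -> 'M[R]_(k, m) -> R;
  form_alternating : forall c p,
    chart_domain c p -> alternating_multilinear (form_val c p);
  form_transition : forall c d p, chart_domain c p -> chart_domain d p ->
    forall V, form_val c p V = form_val d p (V *m transition c d p);
  form_smooth : forall c V,
    smooth_on (chart_image c) (fun x => form_val c (parametrization c x) V)
}.

Record multivector_field (k : nat) := MultivectorField {
  mvf_val :> chart_index M -> M -> 'M[R]_(k, m) -> R;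
  mvf_alternating : forall c p,
    chart_domain c p -> alternating_multilinear (mvf_val c p);
  mvf_transition : forall c d p, chart_domain c p -> chart_domain d p ->
    forall Theta,
      mvf_val d p Theta = mvf_val c p (Theta *m (transition c d p)^T);
  mvf_smooth : forall c Theta,
    smooth_on (chart_image c) (fun x => mvf_val c (parametrization c x) Theta)
}.

Definition volume_form (Omega : diff_form m) :=
  forall c p, chart_domain c p -> exists V, Omega c p V != 0.

Definition differential (f : smooth_function) (c : chart_index M) (p : M) :
    'rV[R]_m -> R :=
  'd (f \o parametrization c) (coordinates c p).

(* df_1 /\ ... /\ df_k *)
Definition wedge_differentials k (f : 'I_k -> smooth_function)
    (c : chart_index M) (p : M) : 'M[R]_(k, m) -> R :=
  wedge_covectors (fun i => differential (f i) c p).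

Definition eq_field k (a b : chart_index M -> M -> 'M[R]_(k, m) -> R) :=
  forall c p, chart_domain c p -> forall V, a c p V = b c p V.

End Fields.

(* Main.v *)
Require Import Defs.
From mathcomp Require Import all_boot all_order all_algebra all_fingroup.
From mathcomp Require Import all_classical all_reals all_analysis.
Import GRing.Theory Num.Theory numFieldNormedType.Exports.

(** The statement is pointwise: at a point p and in a chart c it is the
    identity of multilinear algebra
      a /\ i_L w = <a, L> w
    for a k-form a, a k-vector L and an m-form w on R^m.  Applied to
    a = df_1 /\ .. /\ df_k, L = Lambda and w = Omega it gives
      {f_1, .., f_k} Omega = <df_1 /\ .. /\ df_k, Lambda> Omega,
    and Omega can be cancelled because it does not vanish.

    An m-form on R^m is a multiple of the determinant ([top_form_det]), so it
    suffices to evaluate the identity on the standard basis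
    ([wedge_interior_product_std]).  Both sides are linear in L, and the wedge
    product with i_L w is a sum over the permutations s of the basis.  For L
    replaced by a k-tuple U of vectors, the term of s is, up to sign, the value
    of a on the first k permuted basis vectors times the determinant of U
    completed by the remaining ones; that determinant is the minor of U on the
    first k permuted indices ([det_col_mx_perm]), i.e. the coordinate of
    U_1 /\ .. /\ U_k there, and the two signs of s cancel.  Each multi-index of
    k distinct indices comes from l! permutations, where l = m - k
    ([sum_perm_lshift]), so the sum is l! k! times the pairing of a with
    U_1 /\ .. /\ U_k, which is a(U); the normalization 1/(k! l!) of the wedge
    product removes the factorials ([sum_perm_wedge_contraction]). *)

Set Implicit Arguments.
Unset Strict Implicit.
Local Open Scope ring_scope.

Lemma alternating_basis_tuple (R : realType) (m k : nat)
    (w : 'M[R]_(k, m) -> R) (I : {ffun 'I_k -> 'I_m}) :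
  alternating_multilinear w -> ~~ injectiveb I -> w (basis_tuple I) = 0.
Proof.
move=> wA /injectivePn [i [j ij eI]]; apply: (wA.2 _ i j ij).
by apply/rowP => b; rewrite !mxE eI.
Qed.

(** The multilinear expansion of w over the basis keeps only the injective
    multi-indices; these are the permutations, and reordering the basis turns
    the expansion into the Leibniz formula. *)
Lemma top_form_det (R : realType) (m : nat) (w : 'M[R]_m -> R) (V : 'M[R]_m) :
  alternating_multilinear w -> w V = \det V * w 1%:M.
Proof.
move=> wA; rewrite (multilinear_expansion wA) /determinant mulr_suml.
rewrite (bigID (fun I : {ffun 'I_m -> 'I_m} => injectiveb I)) /=.
rewrite addrC big1 ?add0r; last first.
  by move=> I nI; rewrite (alternating_basis_tuple wA nI) mulr0.
rewrite (reindex (fun s : 'S_m => pval s)) /=; last first.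
  exists (fun I => insubd (1%g : 'S_m) I) => [s _|I iI].
    by apply/val_inj; rewrite /= val_insubd (valP s).
  exact: (insubdK (1%g : 'S_m) iI).
apply: eq_big => [s|s _]; first by rewrite (valP s).
rewrite [in RHS]mulrAC -(alternating_perm wA s) [RHS]mulrC pvalE.
congr (_ * w _).
by apply/matrixP => i j; rewrite !mxE pvalE eq_sym.
Qed.

(** In the orthonormal basis formed by the rows of the permutation matrix, the
    stacked matrix is block triangular with an identity block. *)
Lemma det_col_mx_perm (R : realType) (k l : nat) (U : 'M[R]_(k, k + l))
    (s : 'S_(k + l)) :
  \det (col_mx U (dsubmx (perm_mx s)))
  = (-1) ^+ s * \det (U *m (usubmx (perm_mx s))^T).
Proof.
set P : 'M[R]_(k + l) := perm_mx s.
set u := usubmx P; set d := dsubmx P.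
have PP : u^T *m u + d^T *m d = 1%:M.
  rewrite -mul_row_col -tr_col_mx vsubmxK /P tr_perm_mx -perm_mxM mulVg.
  exact: perm_mx1.
have -> : col_mx U d = block_mx (U *m u^T) (U *m d^T) 0 1%:M *m P.
  rewrite -[P]vsubmxK -/u -/d mul_block_col mul0mx mul1mx add0r.
  by rewrite -!mulmxA -mulmxDr PP mulmx1.
by rewrite det_mulmx det_ublock det1 mulr1 det_perm mulrC.
Qed.

(** List the values of I, then the remaining indices in any order. *)
Lemma injection_extends_perm (k l : nat) (I : {ffun 'I_k -> 'I_(k + l)}) :
  injective I -> exists s : 'S_(k + l), forall i, s (lshift l i) = I i.
Proof.
move=> iI.
pose r := codom I ++ [seq x <- enum 'I_(k + l) | x \notin codom I].
have ur : uniq r.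
  rewrite cat_uniq filter_uniq ?enum_uniq // andbT.
  rewrite (introT (injectiveP _) iI : uniq (codom I)) /=.
  by apply/hasPn => x; rewrite mem_filter => /andP[].
have : perm_eq r (ord_tuple (k + l)).
  apply: uniq_perm => //; first by rewrite val_ord_tuple enum_uniq.
  move=> x; rewrite val_ord_tuple mem_cat mem_filter mem_enum inE andbT.
  by rewrite orbN.
case/tuple_permP => s rE; exists s => i.
have := congr1 (fun t => nth (I i) t i) rE.
rewrite nth_cat size_codom card_ord ltn_ord.
rewrite (nth_map i) ?size_enum_ord // nth_ord_enum => ->.
by rewrite (nth_mktuple _ _ (lshift l i)) tnth_ord_tuple.
Qed.

(** The extensions of I form a coset of the group of the permutations that
    fix the first k indices. *)
Lemma card_perm_extensions (k l : nat) (I : {ffun 'I_k -> 'I_(k + l)}) :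
  injective I ->
  #|[set s : 'S_(k + l) | [ffun i => s (lshift l i)] == I]| = l`!.
Proof.
move=> /injection_extends_perm [s0 s0E].
pose A := [set rshift k i | i in [set: 'I_l]].
have cA : #|A| = l by rewrite card_imset ?cardsT ?card_ord //; apply: rshift_inj.
rewrite -[in RHS]cA -card_perm -[RHS](card_imset _ (mulIg s0)).
apply: eq_card => s; rewrite inE; apply/eqP/imsetP => [sI|[t tA ->]].
  exists (s * s0^-1)%g; last by rewrite mulgKV.
  rewrite unfold_in; apply/fintype.subsetP => x.
  rewrite inE permM; apply: contraR => xA.
  have [j jx|j jx] := splitP x.
    have -> : x = lshift l j by exact/val_inj.
    have := congr1 (fun f : {ffun _ -> _} => f j) sI; rewrite /= ffunE => ->.
    by rewrite -s0E permK.
  case/negP: xA; apply/imsetP; exists j => //; exact/val_inj.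
apply/ffunP => i; rewrite ffunE permM (out_perm tA) ?s0E //.
apply/imsetP => -[j _ /(congr1 val) /= ij].
by have := ltn_ord i; rewrite ij ltnNge leq_addr.
Qed.

(** Grouping the permutations by their restriction to the first k indices. *)
Lemma sum_perm_lshift (R : realType) (k l : nat)
    (g : {ffun 'I_k -> 'I_(k + l)} -> R) :
  (forall I : {ffun 'I_k -> 'I_(k + l)}, ~~ injectiveb I -> g I = 0) ->
  \sum_(s : 'S_(k + l)) g [ffun i => s (lshift l i)] = l`!%:R * \sum_I g I.
Proof.
move=> g0; rewrite (partition_big (fun s : 'S_(k + l) =>
  [ffun i => s (lshift l i)]) xpredT) //= mulr_sumr.
apply: eq_bigr => I _; rewrite (eq_bigr (fun=> g I)) => [|s /eqP-> //].
have [iI|nI] := boolP (injectiveb I); last by rewrite (g0 I nI) big1 ?mulr0.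
rewrite -(card_perm_extensions (elimT (injectiveP _) iI)) mulr_natl -sumr_const.
by apply: eq_bigl => s; rewrite inE.
Qed.

(** The product a /\ i_U w on the standard basis, before normalization, for
    the decomposable k-vector U_1 /\ .. /\ U_k: a Laplace expansion, in which
    the whole summand depends on s only through its restriction to the first k
    indices, because the sign of s occurs twice. *)
Lemma sum_perm_wedge_contraction (R : realType) (k l : nat)
    (a : 'M[R]_(k, k + l) -> R) (w : 'M[R]_(k + l) -> R) (U : 'M[R]_(k, k + l)) :
  alternating_multilinear a -> alternating_multilinear w ->
  \sum_(s : 'S_(k + l)) (-1) ^+ s * a (usubmx (perm_mx s))
     * w (col_mx U (dsubmx (perm_mx s)))
  = k`!%:R * l`!%:R * (a U * w 1%:M).
Proof.
move=> aA wA.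
(* The first k rows of the permutation matrix are the basis tuple of s
   restricted to the first k indices, so the minor of U is a coordinate of the
   wedge of the rows of U. *)
pose g I := a (basis_tuple I) * wedge_vectors U (basis_tuple I).
transitivity (\sum_(s : 'S_(k + l)) g [ffun i => s (lshift l i)] * w 1%:M).
  apply: eq_bigr => s _.
  rewrite /g; have <- : usubmx (perm_mx s)
      = basis_tuple [ffun i => s (lshift l i)] :> 'M[R]_(_, _).
    by apply/matrixP => i j; rewrite !mxE ffunE eq_sym.
  rewrite (top_form_det _ wA) det_col_mx_perm.
  rewrite -[\det (U *m _)]det_tr trmx_mul trmxK -/(wedge_vectors _ _).
  by rewrite !mulrA; congr (_ * _ * _); rewrite mulrAC -expr2 sqrr_sign mul1r.
rewrite -mulr_suml sum_perm_lshift => [|I nI]; last first.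
  by rewrite /g (alternating_basis_tuple aA nI) mul0r.
rewrite -(pairing_wedge_vectors U aA) /pairing -!mulrA [RHS]mulrCA; congr (_ * _).
by rewrite !mulrA mulfV ?mul1r // pnatr_eq0 -lt0n fact_gt0.
Qed.

(** The identity a /\ i_L w = <a, L> w, on the standard basis.  Contraction
    with L is the combination, with weights L(e_I)/k!, of the contractions with
    basis tuples e_I; after exchanging the sums over s and I,
    [sum_perm_wedge_contraction] at U = e_I evaluates the sum over s, and what
    remains is the sum that defines <a, L>. *)
Lemma wedge_interior_product_std (R : realType) (k l n : nat) (e : (k + l = n)%N)
    (a L : 'M[R]_(k, n) -> R) (w : 'M[R]_n -> R) :
  alternating_multilinear a -> alternating_multilinear w ->
  wedge_product e a (interior_product e L w) 1%:M = pairing a L * w 1%:M.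
Proof.
case: n / e a L w => a L w aA wA.
have fne (j : nat) : j`!%:R != 0 :> R by rewrite pnatr_eq0 -lt0n fact_gt0.
rewrite /wedge_product /interior_product /pairing.
under eq_bigr do rewrite castmx_id -/(perm_mx _) mulrCA mulr_sumr.
rewrite -mulr_sumr exchange_big /= mulrCA -mulrA; congr (_ * _).
rewrite mulr_sumr mulr_suml; apply: eq_bigr => I _.
under eq_bigr do rewrite castmx_id mulrA.
rewrite -mulr_suml sum_perm_wedge_contraction //.
by rewrite -[X in _ * X]mulrA mulKf ?mulf_neq0 // mulrAC.
Qed.

(** Covectors given as linear maps are the rows of their coordinates, and
    det (T X^T) is symmetric in T and X: a wedge of covectors has the shape of
    [wedge_vectors], whence its alternation by [alternating_wedge_vectors]. *)
Lemma wedge_covectors_linear (R : realType) (m k : nat)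
    (theta : 'I_k -> {linear 'rV[R]_m -> R}) (X : 'M[R]_(k, m)) :
  wedge_covectors (fun i => theta i) X
  = wedge_vectors (\matrix_(i, j) theta i (delta_mx 0 j)) X.
Proof.
rewrite /wedge_vectors -det_tr trmx_mul trmxK; congr (\det _).
apply/matrixP => i j; rewrite !mxE [row j X]row_sum_delta linear_sum.
by apply: eq_bigr => b _; rewrite linearZ /= !mxE mulrC.
Qed.

Lemma alternating_wedge_vectors (R : realType) (m k : nat) (X : 'M[R]_(k, m)) :
  alternating_multilinear (wedge_vectors X).
Proof.
split=> [A B C i b c hA hB hC|A i j ij hA]; rewrite /wedge_vectors.
  apply: (@determinant_multilinear _ _ _ _ _ i).
  - by rewrite !row_mul hA mulmxDl !scalemxAl.
  - by rewrite !row'Esub -!mul_rowsub_mx -!row'Esub hB.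
  - by rewrite !row'Esub -!mul_rowsub_mx -!row'Esub hC.
apply: (determinant_alternate ij) => b.
have := congr1 (fun r => (r *m X^T) 0 b) hA.
by rewrite -!row_mul !mxE.
Qed.

Unset Implicit Arguments.

Theorem theorem1 (R : realType) (m k : nat) (hk : (k <= m)%N)
    (M : manifold R m) (Omega : diff_form M m) (hOmega : volume_form Omega)
    (alpha : diff_form M (m - k))
    (bracket : ('I_k -> smooth_function M) -> smooth_function M)
    (hbracket : forall f : 'I_k -> smooth_function M,
       eq_field (fun c p V => bracket f p * Omega c p V)
                (fun c p => wedge_product (subnKC hk) (wedge_differentials f c p)
                                  (alpha c p)))
    (Lambda : multivector_field M k)
    (hLambda : eq_field (fun c p => interior_product (subnKC hk) (Lambda c p)
                                                (Omega c p))
                        alpha) :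
  forall (f : 'I_k -> smooth_function M) (c : chart_index M) (p : M),
    chart_domain c p ->
    bracket f p = pairing (wedge_differentials f c p) (Lambda c p).
Proof.
move=> f c p cp.
have wA := form_alternating Omega cp.
have dA : alternating_multilinear (wedge_differentials f c p).
  rewrite (_ : wedge_differentials f c p =
    wedge_vectors (\matrix_(i, j) differential (f i) c p (delta_mx 0 j))).
    exact: alternating_wedge_vectors.
  by apply/funext => X; rewrite -wedge_covectors_linear.
(* Omega is its value on the standard basis times the determinant, so that
   value is nonzero. *)
have w1 : Omega c p 1%:M != 0.
  have [V] := hOmega c p cp.
  by apply: contra_neq => w1; rewrite (top_form_det V wA) w1 mulr0.
apply: (mulIf w1); rewrite (hbracket f c p cp).
rewrite -(wedge_interior_product_std (subnKC hk) _ dA wA).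
by congr wedge_product; apply/funext => V; rewrite (hLambda c p cp).
Qed.
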